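(* Let $L \subseteq \mathbb{R}^n$ be a lattice. Then, for each $\varepsilon > 0$, there exist $\delta > 0$ and $r > 0$ such that for every $x \in \operatorname{span}(L)$ satisfying $|u\,x|_{\mathbb{Z}} \le \delta$ for all $u \in L$ with $\|u\| \le r$, there is a $y \in L'$ such that $\|x - y\| \le \varepsilon$.
   Context: Here $n \ge 1$ is an integer. A lattice in $\mathbb{R}^n$ is a discrete additive subgroup $L$ of $\mathbb{R}^n$ (not necessarily of full rank). $\operatorname{span}(L)$ is the real linear subspace of $\mathbb{R}^n$ generated by $L$. $u\,x = u_1x_1+\ldots+u_nx_n$ is the usual inner product and $\|x\| = \sqrt{x\,x}$ is the euclidean norm. For $a \in \mathbb{R}$, $|a|_{\mathbb{Z}} = \min_{c \in \mathbb{Z}} |a - c|$ is the distance of $a$ from the integers. The dual lattice of $L$ is $L' = \{x \in \operatorname{span}(L) : u\,x \in \mathbb{Z} \text{ for all } u \in L\}$. *)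

(* Defs.v *)
From HB Require Import structures.
From mathcomp Require Import all_boot all_order all_algebra.
From mathcomp Require Import all_classical reals topology normedtype.

Set Implicit Arguments.
Unset Strict Implicit.
Unset Printing Implicit Defensive.
Import Order.TTheory GRing.Theory Num.Theory.
Import numFieldNormedType.Exports.
Local Open Scope classical_set_scope.
Local Open Scope ring_scope.

Definition dotp (R : realType) (n : nat) (u x : 'rV[R]_n) : R :=
  \sum_(i < n) u 0 i * x 0 i.

(* The library's norm on 'rV[R]_n is the sup norm, so the euclidean norm is
   introduced separately; the two induce the same topology. *)
Definition enorm (R : realType) (n : nat) (x : 'rV[R]_n) : R :=
  Num.sqrt (dotp x x).

(* The infimum is a minimum, see [distZ_min]. *)
Definition distZ (R : realType) (a : R) : R :=
  inf [set `|a - c%:~R| | c in [set: int]].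

Definition is_lattice (R : realType) (n : nat) (L : set 'rV[R]_n) : Prop :=
  zmod_closed (mem L) /\ L `<=` isolated L.

Definition rspan (R : realType) (n : nat) (L : set 'rV[R]_n) : set 'rV[R]_n :=
  smallest [set V : set 'rV[R]_n | submod_closed (mem V)] L.

Definition dual_lattice (R : realType) (n : nat) (L : set 'rV[R]_n) :
    set 'rV[R]_n :=
  [set x | rspan L x /\ forall u, L u -> dotp u x \is a Num.int].

Lemma distZ_min (R : realType) (a : R) :
  (exists c : int, distZ a = `|a - c%:~R|) /\
  (forall c : int, distZ a <= `|a - c%:~R|).
Proof.
set S := [set `|a - c%:~R| | c in [set: int]].
have lbS : lbound S 0 by move=> _ [c _ <-].
have hlb : has_lbound S by exists 0.
have le_dist c : distZ a <= `|a - c%:~R| by apply: ge_inf => //; exists c.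
split=> //.
have [m mmin] : exists m : int, forall c : int, `|a - m%:~R| <= `|a - c%:~R|.
  set f := Num.floor a.
  have f_le : f%:~R <= a by exact: floor_le.
  have lt_f : a < (f + 1)%:~R by exact: floorD1_gt.
  have key (c : int) : `|a - f%:~R| <= `|a - c%:~R| \/
                       `|a - (f + 1)%:~R| <= `|a - c%:~R|.
    have [cf|fc] := leP c f; [left|right].
      have cf' : (c%:~R : R) <= f%:~R by rewrite ler_int.
      rewrite !ger0_norm ?subr_ge0 //; last exact: le_trans f_le.
      by rewrite lerD2l lerN2.
    have fc' : ((f + 1)%:~R : R) <= c%:~R by rewrite ler_int lezD1.
    rewrite !ler0_norm ?subr_le0 ?(ltW lt_f) //; last first.
      exact: le_trans (ltW lt_f) fc'.
    by rewrite lerN2 lerD2l lerN2.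
  have [h|h] := leP `|a - f%:~R| `|a - (f + 1)%:~R|; [exists f|exists (f + 1)].
    by move=> c; have [//|] := key c; exact: le_trans.
  by move=> c; have [|//] := key c; apply: le_trans; exact: ltW.
exists m; apply/eqP; rewrite eq_le le_dist /=.
apply: lb_le_inf; first by exists `|a - m%:~R|, m.
by move=> _ [c _ <-]; exact: mmin.
Qed.

(* Main.v *)
Require Import Defs.
From HB Require Import structures.
From mathcomp Require Import all_boot all_order all_algebra.
From mathcomp Require Import all_classical reals topology normedtype.
From mathcomp Require Import lra.
Import Order.TTheory GRing.Theory Num.Theory.
Import numFieldNormedType.Exports.
Local Open Scope classical_set_scope.
Local Open Scope ring_scope.

(** The approximate integrality of [x] against short vectors of [L] is turned
    into exact integrality in two moves.

    Choose linearly independent [v_1, ..., v_k] in [L], the rows of a matrix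
    [A], whose real span contains [L] ([maximal_free_family]).  If each
    [v_i x] is within [delta] of an integer [c_i], there is a unique [z] in the
    span of the [v_i] with [v_i z = v_i x - c_i], given by the Gram matrix of
    the [v_i] ([gram_unit]); its size is at most a constant times [delta].  Put
    [y = x - z]: it lies in the span, is close to [x], and pairs integrally
    with every [v_i].

    The [v_i] need not generate [L], so it remains to see that [y] pairs
    integrally with the rest of [L].  Subtracting an integral combination of
    the [v_i], any [u] in [L] is moved to a vector of [L] whose coordinates on
    the [v_i] are in [0, 1[, hence whose norm is at most [r].  On such vectors
    [u x] is within [delta] of an integer, and so [u y] is within [1/4] of an
    integer for [delta] small.  Thus the subgroup of all [u y], [u] in [L],
    stays within [1/4] of the integers, and this forces it to consist of
    integers ([near_int_multiples_int], [int_pairing_of_near_int]).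

    Sizes are measured by the sum of absolute values [sum_norm], which
    dominates the euclidean norm and makes the bounds on matrix products
    immediate. *)

(** * Subgroups of the reals close to the integers *)

(** Write [a = c + d] with [c] the integer near [a].  As long as
    [j |d| <= 1/4], the next multiple [(j + 1) d] is at most [1/2] away from
    [0] and at most [1/4] away from some integer, which must then be [0]; so
    all multiples of [d] stay below [1/4], and [d = 0]. *)
Lemma near_int_multiples_int (R : realType) (a : R) :
  (forall j : nat, exists c : int, `|a *+ j - c%:~R| <= 4^-1) ->
  a \is a Num.int.
Proof.
move=> near; have [c ac] := near 1%N; rewrite mulr1n in ac.
pose d := a - c%:~R.
have small (j : nat) : `|d *+ j| <= 4^-1.
  elim: j => [|j IHj]; first by rewrite mulr0n normr0; lra.
  have [c' ac'] := near j.+1.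
  pose m := c' - c *+ j.+1.
  have dm : d *+ j.+1 - m%:~R = a *+ j.+1 - c'%:~R.
    by rewrite /m /d mulrnBl rmorphB rmorphMn /= opprB addrA subrK.
  have m0 : m = 0.
    (* [|m| <= 1/4 + 1/4 + 1/4 < 1] *)
    apply/eqP; rewrite -absz_eq0 -leqn0 -ltnS -ltz_nat abszE.
    rewrite -(ltr_int R) intr_norm.
    have := ler_normB (d *+ j.+1) (d *+ j.+1 - m%:~R).
    rewrite subKr dm.
    have := ler_normD d (d *+ j); rewrite -mulrS.
    move: ac; rewrite -/d; lra.
  by move: dm; rewrite m0 subr0 => ->.
have d0 : d = 0.
  apply/eqP; apply: contraT; rewrite -normr_gt0 => d_gt0.
  have := small (Num.bound (4^-1 / `|d|)); rewrite normrMn -[`|d| *+ _]mulr_natl.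
  rewrite leNgt -ltr_pdivrMr //; move/negP; case.
  apply: archi_boundP; apply: divr_ge0; first lra.
  exact: ltW.
have -> : a = c%:~R by apply/eqP; rewrite -subr_eq0 -/d d0.
exact: intr_int.
Qed.

(** * Size estimates and the Gram matrix *)

Section Coordinates.
Context {R : realType}.

Lemma dotp_mulmx {n} (u x : 'rV[R]_n) : dotp u x = (u *m x^T) 0 0.
Proof. by rewrite mxE; apply: eq_bigr => i _; rewrite mxE. Qed.

Lemma dotpDl {n} (u v x : 'rV[R]_n) : dotp (u + v) x = dotp u x + dotp v x.
Proof. by rewrite !dotp_mulmx mulmxDl mxE. Qed.

Lemma dotpBr {n} (u x y : 'rV[R]_n) : dotp u (x - y) = dotp u x - dotp u y.
Proof. by rewrite !dotp_mulmx linearB /= mulmxBr mxE [X in _ + X]mxE. Qed.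

Lemma dotpMnl {n} (u x : 'rV[R]_n) j : dotp (u *+ j) x = dotp u x *+ j.
Proof. by rewrite -sumrMnl; apply: eq_bigr => i _; rewrite mulmxnE mulrnAl. Qed.

Lemma dotp_row {m n} (A : 'M[R]_(m, n)) i (x : 'rV[R]_n) :
  dotp (row i A) x = (x *m A^T) 0 i.
Proof. by rewrite mxE; apply: eq_bigr => j _; rewrite !mxE mulrC. Qed.

Definition sum_norm {m n} (A : 'M[R]_(m, n)) : R := \sum_i \sum_j `|A i j|.

Lemma sum_norm_ge0 {m n} (A : 'M[R]_(m, n)) : 0 <= sum_norm A.
Proof. by apply: sumr_ge0 => i _; apply: sumr_ge0. Qed.

Lemma sum_norm_row {m n} (A : 'M[R]_(m, n)) i : sum_norm (row i A) <= sum_norm A.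
Proof.
rewrite /sum_norm big_ord1 (bigD1 i) //=.
under eq_bigr do rewrite mxE.
by rewrite lerDl; apply: sumr_ge0 => k _; apply: sumr_ge0.
Qed.

Lemma sum_norm_mulmx {m n} (t : 'rV[R]_m) (A : 'M[R]_(m, n)) b :
  (forall i, `|t 0 i| <= b) -> sum_norm (t *m A) <= b * sum_norm A.
Proof.
move=> tb; rewrite /sum_norm big_ord1 exchange_big mulr_sumr.
apply: ler_sum => j _; rewrite mxE mulr_sumr.
apply: le_trans (ler_norm_sum _ _ _) _.
by apply: ler_sum => i _; rewrite normrM ler_wpM2r.
Qed.

Lemma normr_dotp {n} (u x : 'rV[R]_n) : `|dotp u x| <= sum_norm u * sum_norm x.
Proof.
rewrite /sum_norm !big_ord1 mulr_suml.
apply: le_trans (ler_norm_sum _ _ _) _; apply: ler_sum => i _.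
rewrite normrM ler_wpM2l // (bigD1 i) //= lerDl.
exact: sumr_ge0.
Qed.

Lemma enorm_le_sum_norm {n} (x : 'rV[R]_n) : enorm x <= sum_norm x.
Proof.
rewrite -(ger0_norm (sum_norm_ge0 x)) -sqrtr_sqr ler_wsqrtr // expr2.
exact: le_trans (ler_norm _) (normr_dotp _ _).
Qed.

(** A row [w] killed by [A *m A^T] gives a vector [w *m A] orthogonal to
    itself, hence zero. *)
Lemma gram_unit {m n} (A : 'M[R]_(m, n)) : row_free A -> A *m A^T \in unitmx.
Proof.
move=> fA; rewrite -row_free_unit -kermx_eq0; apply/rowV0P => w /sub_kermxP.
move=> wA; apply/eqP; rewrite -(mulmx_free_eq0 _ fA); apply/eqP.
have dot0 : dotp (w *m A) (w *m A) = 0.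
  by rewrite dotp_mulmx trmx_mul mulmxA -(mulmxA w) wA mul0mx mxE.
apply/rowP => j; rewrite [RHS]mxE; apply/eqP.
rewrite -sqrf_eq0 expr2; apply/eqP.
apply: (psumr_eq0P _ dot0) => // i _.
by rewrite -expr2 sqr_ge0.
Qed.

End Coordinates.

(** * Free families in a subgroup *)

Lemma row_free_adjoin {F : fieldType} {k n} (u : 'rV[F]_n) (A : 'M[F]_(k, n)) :
  row_free A -> ~~ (u <= A)%MS -> row_free (col_mx u A).
Proof.
move=> /eqP rA uA; rewrite /row_free eqn_leq rank_leq_row /= -addsmxE add1n.
rewrite -[X in (X < _)%N]rA; apply: rank_ltmx.
by rewrite ltmxE addsmxSr addsmx_sub negb_and uA.
Qed.

Section Subgroup.
Context {R : realType} {n : nat} {L : set 'rV[R]_n}.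

(** Families are bounded in length by [n]; in a longest one, a vector of [L]
    outside the span could be adjoined. *)
Lemma maximal_free_family : exists k (A : 'M[R]_(k, n)),
  [/\ row_free A, forall i, L (row i A) &
      forall u, L u -> exists t : 'rV[R]_k, u = t *m A].
Proof.
pose P k := `[< exists A : 'M[R]_(k, n), row_free A /\ forall i, L (row i A) >].
have exP : exists k, P k.
  (* the empty family *)
  exists 0%N; apply/asboolP; exists 0; split; last by case.
  by rewrite /row_free mxrank0.
have leP k : P k -> (k <= n)%N.
  case/asboolP=> A [fA _]; move/eqP: fA => kE.
  by rewrite -[leqLHS]kE rank_leq_col.
case: (ex_maxnP exP leP) => k /asboolP[A [fA LA]] maxk.
exists k, A; split=> // u Lu; apply/submxP; apply: contraT => uA.
suff /maxk : P k.+1 by rewrite ltnn.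
apply/asboolP; exists (col_mx u A : 'M_(1 + k, n)); split; last first.
  move=> i; rewrite -[i](@splitK 1 k); case: (@fintype.split 1 k i) => j.
    by rewrite (_ : row _ _ = u) // -[RHS](row_id j); exact: rowKu.
  by rewrite (_ : row _ _ = row j A) //; exact: rowKd.
exact: row_free_adjoin.
Qed.

Hypothesis L_zmod : zmod_closed (mem L).

Lemma zmod_mulrn u j : L u -> L (u *+ j).
Proof.
pose S : zmodClosed _ :=
  HB.pack (fun x => x \in mem L) (GRing.isZmodClosed.Build _ _ L_zmod).
by move=> /mem_set Lu; apply/set_mem; exact: (@rpredMn _ S).
Qed.

Lemma zmod_sub u v : L u -> L v -> L (u - v).
Proof.
by move=> /mem_set Lu /mem_set Lv; apply/set_mem; case: L_zmod => _; apply.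
Qed.

Lemma zmod_int_comb {k} (A : 'M[R]_(k, n)) (c : 'I_k -> int) :
  (forall i, L (row i A)) -> L ((\row_i (c i)%:~R) *m A).
Proof.
pose S : zmodClosed _ :=
  HB.pack (fun x => x \in mem L) (GRing.isZmodClosed.Build _ _ L_zmod).
move=> LA; apply/set_mem; rewrite mulmx_sum_row.
apply: (@rpred_sum _ S) => i _; rewrite mxE scaler_int.
by apply: (@rpredMz _ S); exact: mem_set.
Qed.

End Subgroup.

(** * Real span *)

Lemma rspan_submod_closed {R : realType} {n} (L : set 'rV[R]_n) :
  submod_closed (mem (rspan L)).
Proof.
split=> [|a u v /set_mem Lu /set_mem Lv]; apply/mem_set => M MP;
  have [[M0 Mlin] _] := MP; apply/set_mem => //.
by apply: Mlin; apply/mem_set; [exact: (Lu M MP) | exact: (Lv M MP)].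
Qed.

Lemma rspan_sub_comb {R : realType} {n} (L : set 'rV[R]_n) x {k}
    (t : 'rV[R]_k) (A : 'M[R]_(k, n)) :
  rspan L x -> (forall i, L (row i A)) -> rspan L (x - t *m A).
Proof.
pose S : submodClosed _ := HB.pack (fun x => x \in mem (rspan L))
  (GRing.isSubmodClosed.Build _ _ _ (@rspan_submod_closed R n L)).
move=> /mem_set Lx LA; suff: x - t *m A \in mem (rspan L) by move/set_mem.
rewrite -mulNmx; apply: (@rpredD _ S) => //; rewrite mulmx_sum_row.
apply: (@rpred_sum _ S) => i _; apply: (@rpredZ _ _ S).
by apply/mem_set => M [_]; apply.
Qed.

(** * From approximate to exact integrality *)

Lemma mulmx_floor_frac {R : realType} {k n} (t : 'rV[R]_k) (A : 'M[R]_(k, n)) :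
  t *m A = (\row_i (Num.floor (t 0 i))%:~R) *m A +
           (\row_i (t 0 i - (Num.floor (t 0 i))%:~R)) *m A.
Proof.
by rewrite -mulmxDl; congr (_ *m _); apply/rowP => i; rewrite !mxE subrKC.
Qed.

(** For [u] in [L], every multiple [u *+ j] differs by an integral combination
    of the rows of [A] from a vector [f] of [L] with coordinates in [0, 1[,
    whose size is at most that of [A].  Hence all multiples of [dotp u y] are
    within [1/4] of the integers. *)
Lemma int_pairing_of_near_int {R : realType} {n} (L : set 'rV[R]_n) {k}
    (A : 'M[R]_(k, n)) (y : 'rV[R]_n) :
  zmod_closed (mem L) -> (forall i, L (row i A)) ->
  (forall u, L u -> exists t : 'rV[R]_k, u = t *m A) ->
  (forall i, dotp (row i A) y \is a Num.int) ->
  (forall u, L u -> sum_norm u <= sum_norm A ->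
     exists c : int, `|dotp u y - c%:~R| <= 4^-1) ->
  forall u, L u -> dotp u y \is a Num.int.
Proof.
move=> L_zmod LA genA intA near u Lu; apply: near_int_multiples_int => j.
rewrite -dotpMnl; have Luj := zmod_mulrn L_zmod _ j Lu.
have [t tE] := genA _ Luj.
pose c := \row_i (Num.floor (t 0 i))%:~R : 'rV[R]_k.
pose f := (\row_i (t 0 i - (Num.floor (t 0 i))%:~R)) *m A.
have ujE : u *+ j = c *m A + f by rewrite tE mulmx_floor_frac.
have Lf : L f.
  rewrite -[f](addKr (c *m A)) -ujE addrC; apply: zmod_sub => //.
  exact: zmod_int_comb.
have [|c1 c1E] := near f Lf.
  rewrite -[leRHS]mul1r; apply: sum_norm_mulmx => i; rewrite mxE.
  have := floor_le (t 0 i); have := floorD1_gt (t 0 i).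
  rewrite rmorphD /= => h1 h2; rewrite ger0_norm ?subr_ge0 //; lra.
have /intrP[c2 c2E] : dotp (c *m A) y \is a Num.int.
  rewrite dotp_mulmx -mulmxA mxE rpred_sum // => i _; rewrite mxE.
  rewrite rpredM ?intr_int //.
  by have := intA i; rewrite dotp_mulmx -row_mul mxE.
exists (c2 + c1); rewrite ujE dotpDl c2E rmorphD /= opprD addrACA subrr add0r.
exact: c1E.
Qed.

Theorem theorem0p1 (R : realType) (n : nat) (hn : (1 <= n)%N)
    (L : set 'rV[R]_n) (hL : is_lattice L) :
  forall eps : R, 0 < eps ->
  exists delta r : R, [/\ 0 < delta, 0 < r &
    forall x : 'rV[R]_n, rspan L x ->
      (forall u : 'rV[R]_n, L u -> enorm u <= r ->
         distZ (dotp u x) <= delta) ->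
      exists2 y : 'rV[R]_n, dual_lattice L y & enorm (x - y) <= eps].
Proof.
have [L_zmod _] := hL.
have [k [A [fA LA genA]]] := @maximal_free_family R n L.
move=> eps eps_gt0.
(* For a row [d], [d *m W] is the vector of the span of the rows of [A] whose
   pairings with these rows are the entries of [d]. *)
pose W := invmx (A *m A^T) *m A.
pose a := sum_norm A; pose w := sum_norm W.
have a_ge0 : 0 <= a := sum_norm_ge0 A.
have w_ge0 : 0 <= w := sum_norm_ge0 W.
(* With [delta = D^-1] the correction [z] has size at most [delta * w]: the
   first summand makes this at most [eps], the second one makes the error
   [delta + a * (delta * w)] on [dotp u y] at most [1/4]. *)
pose D := w / eps + 4 * (1 + a * w).
have D_ge1 : w / eps <= D by rewrite lerDl mulr_ge0 // addr_ge0 // mulr_ge0.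
have D_ge2 : 4 * (1 + a * w) <= D by rewrite lerDr divr_ge0 // ltW.
have D_gt0 : 0 < D.
  by apply: lt_le_trans D_ge2; rewrite mulr_gt0 // ltr_pwDl // mulr_ge0.
(* [a + 1] rather than [a], which is [0] for the trivial lattice. *)
exists D^-1, (a + 1); split; [by rewrite invr_gt0 | by rewrite ltr_wpDl |].
move=> x Lx xnear.
have near u : L u -> sum_norm u <= a ->
    exists c : int, `|dotp u x - c%:~R| <= D^-1.
  move=> Lu ua; have [[c cE] _] := distZ_min (dotp u x); exists c; rewrite -cE.
  apply: xnear => //; apply: le_trans (enorm_le_sum_norm u) _.
  by rewrite (le_trans ua) // lerDl.
have /choice[c cP] : forall i, exists c : int,
    `|dotp (row i A) x - c%:~R| <= D^-1.
  by move=> i; apply: near => //; exact: sum_norm_row.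
pose d := \row_i (dotp (row i A) x - (c i)%:~R) : 'rV[R]_k.
pose z := d *m W.
have zA : z *m A^T = d.
  by rewrite /z /W -!mulmxA mulVmx ?gram_unit // mulmx1.
have z_small : sum_norm z <= D^-1 * w.
  by apply: sum_norm_mulmx => i; rewrite mxE.
have xBy : x - (x - z) = z by rewrite subKr.
exists (x - z); last first.
  rewrite xBy; apply: le_trans (enorm_le_sum_norm z) _.
  apply: le_trans z_small _; rewrite mulrC ler_pdivrMr //.
  by rewrite mulrC -ler_pdivrMr.
split.
  by rewrite /z /W mulmxA; exact: rspan_sub_comb.
apply: (@int_pairing_of_near_int R n L k A) => //.
  move=> i; rewrite dotpBr [X in _ - X]dotp_row zA mxE subKr.
  exact: intr_int.
move=> u Lu ua; have [m mP] := near u Lu ua; exists m.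
rewrite dotpBr addrAC; apply: le_trans (ler_normB _ _) _.
have uz : `|dotp u z| <= a * (D^-1 * w).
  apply: le_trans (normr_dotp _ _) _.
  by apply: ler_pM => //; exact: sum_norm_ge0.
apply: le_trans (lerD mP uz) _.
rewrite mulrCA -{1}[D^-1]mulr1 -mulrDr mulrC ler_pdivrMr //.
by move: D_ge2; lra.
Qed.
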